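(* Let $G$ be a 2-connected, linear-convex supergrid graph. Then $G$ contains a Hamiltonian cycle.
   Context: The two-dimensional supergrid $S^\infty$ is the infinite graph whose vertex set is $\mathbb{Z}^2$, in which two distinct vertices $(a,b)$ and $(c,d)$ are adjacent if and only if $|a-c|\le 1$ and $|b-d|\le 1$. A supergrid graph is a finite vertex-induced subgraph of $S^\infty$. A supergrid graph $G$ is linear-convex if for every line $l$ in the plane that contains an edge of $S^\infty$ (every horizontal, vertical, slope $+1$ or slope $-1$ line through integer points), the intersection of $l$ with $G$ is either empty, a single vertex, or a line segment forming a path of $G$; equivalently, the vertices of $G$ on $l$ form a (possibly empty) set of consecutive lattice points of $l$. A graph is 2-connected if there are two internally vertex-disjoint paths between every pair of its vertices (with the standard convention that it has at least three vertices). A Hamiltonian cycle is a simple cycle visiting every vertex of $G$ exactly once. *)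

(* Defs.v *)
From mathcomp Require Import all_boot all_order all_algebra finmap.

Set Implicit Arguments.
Unset Strict Implicit.
Unset Printing Implicit Defensive.

Import Order.TTheory GRing.Theory Num.Theory.

Local Open Scope ring_scope.

Notation point := (int * int)%type.

Definition sg_adj : rel point := fun p q =>
  [&& p != q, `|p.1 - q.1| <= 1 & `|p.2 - q.2| <= 1].

(* A finite vertex-induced subgraph is determined by its vertex set V; its
   vertices are the elements of the finite type associated with V. *)
Definition supergrid (V : {fset point}) : rel V :=
  fun u v => sg_adj (val u) (val v).
Arguments supergrid : clear implicits.

(* Since coordinates of adjacent points differ by at most 1, the lattice points
   of the line through an edge {p, q} are exactly the p + k (q - p), k an
   integer.  The set of consecutive ones is empty when n < m. *)
Definition linear_convex (V : {fset point}) : Prop :=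
  forall p q : point, sg_adj p q ->
  exists m n : int, forall k : int,
    ((p.1 + k * (q.1 - p.1), p.2 + k * (q.2 - p.2)) \in V) = (m <= k <= n).

Section FiniteGraph.

Variables (T : finType) (e : rel T).

(* The path x, s, y with list of internal vertices s. *)
Definition simple_path (x y : T) (s : seq T) : bool :=
  path e x (rcons s y) && uniq (x :: rcons s y).

(* The condition s1 <> s2 matters only when x and y are adjacent: it prevents
   the edge xy from being counted as two (internally disjoint) paths. *)
Definition two_connected : Prop :=
  (3 <= #|T|)%N /\
  forall x y : T, x != y ->
  exists s1 s2 : seq T,
    [/\ simple_path x y s1, simple_path x y s2, s1 <> s2
      & forall z : T, z \in s1 -> z \notin s2].

(* The size condition excludes the degenerate cycles accepted by [ucycle]
   (the empty one, and an edge traversed back and forth). *)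
Definition hamiltonian_cycle (c : seq T) : Prop :=
  [/\ (3 <= size c)%N, ucycle e c & forall x : T, x \in c].

End FiniteGraph.

(* Main.v *)
(* Take a cycle c of maximal length, with successor v+ and predecessor v-, and
   suppose that it misses x.  Three exchanges would lengthen c.  So, for v and w
   on c adjacent to x: x is not adjacent to v+ or v-; v+ is not adjacent to w+, nor
   v- to w-; and when v- and v+ are adjacent, so that v can be bypassed, v cannot
   be reinserted next to w together with x, hence is not adjacent to w+ or w-.
   In a 2-connected linear-convex graph neighbourhoods are connected, since a
   disconnected one would make its centre a cut vertex.  Hence there is a triangle
   x, v, w with x off c and v, w on c.  Its right angle is at x or on c, and in
   each case the exclusions above together with convexity leave no possible
   positions for the cycle neighbours of v and w. *)
Require Import Defs.
From mathcomp Require Import all_boot all_order all_algebra finmap.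
From mathcomp Require Import zify.

Set Implicit Arguments.
Unset Strict Implicit.
Unset Printing Implicit Defensive.

Import Order.TTheory GRing.Theory Num.Theory.

(** * Paths, cycles and cycle exchanges in a symmetric finite graph *)

Section CycleExtension.

Variables (T : finType) (e : rel T).
Hypothesis e_sym : symmetric e.

Lemma path_exit (P : pred T) x p :
  path e x p -> P x -> ~~ P (last x p) ->
  exists u w, [/\ e u w, u \in x :: p, w \in x :: p, P u & ~~ P w].
Proof.
elim: p x => [|y p IHp] x /= => [_ -> //|/andP[exy pyp] Px nPl].
case Py: (P y); last by exists x, y; rewrite !inE !eqxx orbT Py.
have [u [w [euw up wp Pu nPw]]] := IHp y pyp Py nPl.
by exists u, w; split; rewrite // inE (up, wp) orbT.
Qed.

(** At least one of two internally disjoint paths from [a] to [b] avoids [z], and it must leave [P]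
    somewhere. In this form 2-connectivity says that [z] is not a cut vertex. *)
Lemma two_connected_exit (P : pred T) z a b :
  two_connected e -> a != z -> b != z -> P a -> ~~ P b ->
  exists u w, [/\ e u w, u != z, w != z, P u & ~~ P w].
Proof.
case=> _ conn az bz Pa nPb.
have /conn[s1 [s2 [/andP[p1 _] /andP[p2 _] _ s12]]] : a != b.
  by apply: contraNneq nPb => <-.
have [s [ps zs]] : exists s, path e a (rcons s b) /\ z \notin s.
  by case zs1: (z \in s1); [exists s2; rewrite s12 | exists s1; rewrite zs1].
have zall t : t \in a :: rcons s b -> t != z.
  by rewrite inE mem_rcons inE => /or3P[/eqP->|/eqP->|ts] //; apply: contraNneq zs => <-.
have [|u [w [euw us ws Pu nPw]]] := path_exit ps Pa; first by rewrite last_rcons.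
by exists u, w; split=> //; apply: zall.
Qed.

Lemma rev_ucycle c : ucycle e c -> ucycle e (rev c).
Proof.
case/andP=> ec uc; apply/andP; split; last by rewrite rev_uniq.
by rewrite rev_cycle (eq_cycle (e' := e)).
Qed.

Lemma two_connected_cycle :
  two_connected e -> exists2 c, ucycle e c & (2 < size c)%N.
Proof.
case=> T3 conn.
have [x [y xy]] : exists x y : T, x != y.
  have /card_gt1P[x [y [_ _ xy]]] : (1 < #|T|)%N by exact: ltnW.
  by exists x, y.
have [s1 [s2 [/andP[p1 u1] /andP[p2 u2] ns s12]]] := conn _ _ xy.
exists (x :: s1 ++ y :: rev s2).
  apply/andP; split.
    rewrite /= rcons_cat /= cat_path.
    move: p1; rewrite rcons_path => /andP[-> /= ->] /=.
    rewrite -rev_cons.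
    have := p2; rewrite -(revK (rcons s2 y)).
    have := rev_path e x (rcons s2 y).
    rewrite last_rcons belast_rcons revK => -> p2'.
    by move: p2'; rewrite (eq_path (e' := e)).
  have s2s1 : ~~ has (mem s1) s2.
    by apply/hasPn => z; apply: contraL => /= /s12.
  move: u1 u2; rewrite /= !rcons_uniq !mem_rcons !inE !negb_or.
  case/and3P=> /andP[_ xs1] ys1 us1 /and3P[/andP[_ xs2] ys2 us2].
  rewrite mem_cat inE mem_rev !negb_or xs1 xy xs2 cat_uniq /= us1 mem_rev ys2.
  by rewrite rev_uniq us2 has_rev negb_or ys1 s2s1.
rewrite /= size_cat /= size_rev !ltnS addnS ltnS.
(* As [s1 <> s2], one of the lists is non-empty and supplies a third vertex. *)
by case: s1 s2 ns {p1 p2 u1 u2 s12} => [|? ?] [|? ?].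
Qed.

(** The nested defaults of [head] carry the wrap-around: to the start of [s1], or to [w] itself when
    it is alone. *)
Lemma next_cat_cons (s1 s2 : seq T) w :
  uniq (s1 ++ w :: s2) -> next (s1 ++ w :: s2) w = head (head w s1) s2.
Proof.
move=> us; rewrite -(next_rot (size s1) us) rot_size_cat /=.
by case: s2 {us} => [|? ?]; case: s1 => [|? ?]; rewrite /= eqxx.
Qed.

Lemma prev_cons (s : seq T) v : uniq (v :: s) -> prev (v :: s) v = last v s.
Proof.
move=> us; have := us; rewrite -rev_uniq -(next_rev us) rev_cons -cats1 => us1.
rewrite next_cat_cons //=; case/lastP: s {us us1} => // s y.
by rewrite rev_rcons last_rcons.
Qed.

Variable c : seq T.
Hypothesis ucyc : ucycle e c.

Let uniq_c : uniq c. Proof. by case/andP: ucyc. Qed.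

Lemma ucycle_longer x s :
  x \notin c -> cycle e s -> perm_eq s (x :: c) ->
  exists2 c', ucycle e c' & (size c < size c')%N.
Proof.
move=> xc es ps; exists s; last by rewrite (perm_size ps).
by rewrite /ucycle es (perm_uniq ps) /= xc uniq_c.
Qed.

Lemma next_insert x v :
  x \notin c -> v \in c -> e v x -> e x (next c v) ->
  exists2 c', ucycle e c' & (size c < size c')%N.
Proof.
move=> xc vc evx; have [i s Es] := rot_to vc; rewrite -(next_rot i uniq_c) Es.
have [es us] : cycle e (v :: s) /\ uniq (v :: s) by rewrite -Es rot_cycle rot_uniq; apply/andP.
rewrite (next_cat_cons (s1 := [::])) //= => ex.
apply: (ucycle_longer (s := [:: v, x & s]) xc).
  by move: es ex; rewrite /= evx; case: (s) => [|a t] /= => [_ ->|/andP[_ ->] ->].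
have /permPr <- : perm_eq (x :: v :: s) (x :: c) by rewrite perm_cons -Es perm_rot.
by rewrite (perm_catCA [:: v] [:: x]).
Qed.

(** Go from [v] through [x] to [w], run backwards along the arc down to the old successor of [v],
    then jump to the old successor of [w]. *)
Lemma next_cross x v w :
  x \notin c -> v \in c -> w \in c -> v != w -> e v x -> e x w ->
  e (next c v) (next c w) ->
  exists2 c', ucycle e c' & (size c < size c')%N.
Proof.
move=> xc vc wc vw evx exw; have [i s Es] := rot_to vc.
rewrite -!(next_rot i uniq_c) Es.
have [es us] : cycle e (v :: s) /\ uniq (v :: s) by rewrite -Es rot_cycle rot_uniq; apply/andP.
have ws : w \in s by move: wc; rewrite -(mem_rot i) Es inE eq_sym (negbTE vw).
case/splitPr: ws es us Es => s1 s2 es us Es.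
rewrite (next_cat_cons (s1 := [::])) // -cat_cons next_cat_cons //= => ehd.
apply: (ucycle_longer (s := [:: v, x, w & rev s1 ++ s2]) xc).
  move: es ehd; rewrite /= evx exw !rcons_cat !cat_path /=.
  case: s1 {us Es} => [|a s1] /= => [/andP[_ ->] //|/and3P[/andP[_ p1] ew p2] ehd].
  have -> : path e w (rev (a :: s1)).
    have := rev_path e a (rcons s1 w); rewrite last_rcons belast_rcons => ->.
    by rewrite (@eq_path _ _ e) // rcons_path p1.
  rewrite rev_cons last_rcons /=.
  by case: (s2) p2 ehd => [|b t] /= => [_ ->|/andP[_ ->] ->].
have /permPr <- : perm_eq (x :: v :: s1 ++ w :: s2) (x :: c) by rewrite perm_cons -Es perm_rot.
rewrite (perm_catCA [:: v] [:: x] (w :: _)) !perm_cons perm_sym.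
by rewrite (perm_catCA s1 [:: w]) perm_cons perm_cat2r perm_sym perm_rev.
Qed.

(** [v] is cut out by the edge between its two neighbours and put back, after [x], between [u] and
    the successor of [u]. *)
Lemma next_bypass x u v :
  x \notin c -> u \in c -> v \in c -> u != v -> next c u != v ->
  e u x -> e x v -> e v (next c u) -> e (prev c v) (next c v) ->
  exists2 c', ucycle e c' & (size c < size c')%N.
Proof.
move=> xc uc vc uv + eux exv; have [i s Es] := rot_to vc.
rewrite -!(next_rot i uniq_c) -(prev_rot i uniq_c) Es.
have [es us] : cycle e (v :: s) /\ uniq (v :: s) by rewrite -Es rot_cycle rot_uniq; apply/andP.
have us' : u \in s by move: uc; rewrite -(mem_rot i) Es inE (negbTE uv).
case/splitPr: us' es us Es => s1 s2 es us Es.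
rewrite prev_cons // (next_cat_cons (s1 := [::])) // -cat_cons next_cat_cons //=.
(* An empty [s2] would make [v] the successor of [u]. *)
case: s2 es us Es => [|u' s2] es us Es /=; rewrite ?eqxx // => _ evu ehd.
apply: (ucycle_longer (s := s1 ++ [:: u, x, v, u' & s2]) xc).
  move: es ehd; rewrite /= rcons_cat cat_path.
  case: s1 {us Es} => [|a s1] /=.
    by rewrite eux exv evu /= !rcons_path => /and4P[_ _ -> _].
  rewrite !rcons_cat last_cat /= !rcons_path cat_path => /andP[/andP[_ ps1]].
  rewrite /= eux exv evu rcons_path => /and3P[eu _ /andP[p2 _]] el.
  by rewrite ps1 eu p2.
have /permPr <- : perm_eq (x :: v :: s1 ++ [:: u, u' & s2]) (x :: c).
  by rewrite perm_cons -Es perm_rot.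
rewrite (perm_catCA s1 [:: u; x; v]) perm_sym.
by rewrite (perm_catCA (x :: v :: s1) [:: u]).
Qed.

End CycleExtension.

(** A Boolean direction lets one statement cover successors and predecessors; [~~ d] gives the other
    neighbour on the cycle. *)
Definition turn (T : eqType) (d : bool) (c : seq T) v :=
  if d then next c v else prev c v.
Arguments turn : simpl never.

(** * Edges excluded by the maximality of a cycle *)

Section MaximalCycle.

Variables (T : finType) (e : rel T) (c : seq T).
Hypotheses (e_sym : symmetric e) (ucyc : ucycle e c).
Hypothesis maxc : forall c', ucycle e c' -> (size c' <= size c)%N.

Let not_longer : (exists2 c', ucycle e c' & (size c < size c')%N) -> False.
Proof. by case=> c' /maxc; rewrite leqNgt => /negbTE->. Qed.

Let uniq_c : uniq c. Proof. by case/andP: ucyc. Qed.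

Lemma mem_turn d v : (turn d c v \in c) = (v \in c).
Proof. by case: d; rewrite /turn (mem_next, mem_prev). Qed.

Lemma turn_inj d : injective (turn d c).
Proof. by case: d; [exact: can_inj (prev_next _) | exact: can_inj (next_prev _)]. Qed.

Lemma turn_adj d v : v \in c -> e v (turn d c v).
Proof.
have /andP[ec _] := ucyc; case: d => vc; first exact: next_cycle.
by rewrite e_sym; apply: prev_cycle.
Qed.

Lemma turn_neq d v : (2 < size c)%N -> v \in c -> turn d c v != turn (~~ d) c v.
Proof.
move=> c3 vc; suff: next c v != prev c v by case: d; rewrite /turn // eq_sym.
have [i s Es] := rot_to vc; move: uniq_c c3.
rewrite -(next_rot i uniq_c) -(prev_rot i uniq_c) -(size_rot i c) -(rot_uniq i) Es.
case: s {Es} => [|a [|b s]] // us _; rewrite prev_cons // (next_cat_cons (s1 := [::])) //=.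
by case/and3P: us => _ + _; apply: contraNneq => ->; apply: mem_last.
Qed.

(** Predecessors are successors on the reversed cycle, which has the same length; the next two
    exclusions use the same reduction. *)
Lemma max_insert d x v : x \notin c -> v \in c -> e v x -> ~~ e x (turn d c v).
Proof.
move=> xc vc evx; apply/negP => ex; apply: not_longer.
rewrite /turn in ex; case: d ex => /= ex.
  exact: (next_insert ucyc xc vc evx ex).
rewrite -(size_rev c); rewrite -next_rev // in ex.
by apply: (next_insert (rev_ucycle e_sym ucyc) _ _ evx ex); rewrite mem_rev.
Qed.

Lemma max_cross d x v w :
  x \notin c -> v \in c -> w \in c -> v != w -> e v x -> e x w ->
  ~~ e (turn d c v) (turn d c w).
Proof.
move=> xc vc wc vw evx exw; apply/negP => ex; apply: not_longer.
rewrite /turn in ex; case: d ex => /= ex.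
  exact: (next_cross e_sym ucyc xc vc wc vw evx exw ex).
rewrite -(size_rev c); rewrite -!next_rev // in ex.
by apply: (next_cross e_sym (rev_ucycle e_sym ucyc) _ _ _ vw evx exw ex); rewrite mem_rev.
Qed.

Lemma max_bypass d d' x u v :
  x \notin c -> u \in c -> v \in c -> u != v -> turn d' c u != v ->
  e u x -> e x v -> e (turn d c v) (turn (~~ d) c v) -> ~~ e v (turn d' c u).
Proof.
move=> xc uc vc uv tuv eux exv epn; apply/negP => ev; apply: not_longer.
have {}epn : e (prev c v) (next c v) by case: d epn; rewrite /turn //= e_sym.
rewrite /turn in tuv ev; case: d' tuv ev => /= tuv ev.
  exact: (next_bypass ucyc xc uc vc uv tuv eux exv ev epn).
rewrite e_sym in epn; rewrite -(size_rev c).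
rewrite -!next_rev // -(prev_rev uniq_c) in tuv ev epn.
by apply: (next_bypass (rev_ucycle e_sym ucyc) _ _ _ uv tuv eux exv ev epn); rewrite mem_rev.
Qed.

End MaximalCycle.

(** * Integer coordinates, convexity and the symmetries of the square *)

Local Open Scope ring_scope.

(* Charts are stable under the symmetries of the square, which is how the
   without-loss-of-generality steps below choose a position. *)
Record lc_chart (T : finType) (e : rel T) (X Y : T -> int) : Prop := LcChart {
  chart_inj : forall u v, X u = X v -> Y u = Y v -> u = v;
  chart_adj : forall u v,
    e u v = [&& u != v, `|X u - X v| <= 1 & `|Y u - Y v| <= 1];
  chart_convex : forall (a b j k : int) u w, `|a| <= 1 -> `|b| <= 1 ->
    X w = X u + k * a -> Y w = Y u + k * b -> 0 <= j <= k ->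
    exists t, X t = X u + j * a /\ Y t = Y u + j * b }.

Section Charts.

Variables (T : finType) (e : rel T).

Lemma supergrid_chart (V : {fset point}) : linear_convex V ->
  lc_chart (supergrid V) (fun u => (val u).1) (fun u => (val u).2).
Proof.
move=> convV; split=> [u v Xuv Yuv | u v | a b j k u w la lb Xw Yw jk].
- by apply: val_inj; rewrite [val u]surjective_pairing Xuv Yuv -surjective_pairing.
- by [].
(* The zero direction spans no line, so it is treated apart. *)
have [/andP[/eqP a0 /eqP b0]|ab0] := boolP ((a == 0) && (b == 0)).
  by exists u; rewrite a0 b0; lia.
have [|m [n mn]] := convV (val u) ((val u).1 + a, (val u).2 + b).
  rewrite /sg_adj /=; apply/and3P; split; try lia.
  by apply: contra ab0 => /eqP/(congr1 (fun p => (p.1, p.2))) /= [E1 E2]; lia.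
have inV t : (m <= t <= n) = (((val u).1 + t * a, (val u).2 + t * b) \in V).
  by rewrite -mn /=; do 2 f_equal; f_equal; lia.
(* [u] and [w] have parameters 0 and [k] on the line, so the interval contains [j] as well. *)
have m0 : m <= 0 <= n by rewrite inV !mul0r !addr0; case: (u) => -[].
have mk : m <= k <= n by rewrite inV -Xw -Yw; case: (w) => -[].
have jV : m <= j <= n by lia.
by rewrite inV in jV; exists [` jV]%fset.
Qed.

Lemma chart_sym X Y : lc_chart e X Y -> symmetric e.
Proof. by case=> _ adj _ u v; rewrite !adj eq_sym; lia. Qed.

Lemma chart_swap X Y : lc_chart e X Y -> lc_chart e Y X.
Proof.
case=> inj adj conv; split=> [u v Yuv Xuv | u v | a b j k u w la lb Yw Xw jk].
- exact: inj.
- by rewrite adj (andbC (_ <= _)).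
- by have [t [? ?]] := conv b a j k u w lb la Xw Yw jk; exists t.
Qed.

Lemma chart_oppX X Y : lc_chart e X Y -> lc_chart e (fun u => - X u) Y.
Proof.
case=> inj adj conv; split=> [u v Xuv Yuv | u v | a b j k u w la lb Xw Yw jk].
- by apply: inj => //; apply: oppr_inj.
- by rewrite adj; congr [&& _, _ & _]; lia.
have [||t [Xt Yt]] := conv (- a) b j k u w _ lb _ Yw jk; [lia | lia |].
by exists t; split; lia.
Qed.

Lemma chart_oppY X Y : lc_chart e X Y -> lc_chart e X (fun u => - Y u).
Proof. by move/chart_swap/chart_oppX/chart_swap. Qed.

Lemma chart_row X Y u w (m : int) : lc_chart e X Y -> Y w = Y u -> X u <= m <= X w ->
  exists t, X t = m /\ Y t = Y u.
Proof.
move=> ch Yw m_uw; have [|||t [Xt Yt]] :=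
  @chart_convex _ _ _ _ ch 1 0 (m - X u) (X w - X u) u w isT isT; try lia.
by exists t; lia.
Qed.

Lemma chart_col X Y u w (m : int) : lc_chart e X Y -> X w = X u -> Y u <= m <= Y w ->
  exists t, X t = X u /\ Y t = m.
Proof.
by move/chart_swap=> ch Xw /(chart_row ch Xw)[t [? ?]]; exists t.
Qed.

Lemma chart_edge X Y u w : lc_chart e X Y -> e u w ->
  [/\ u != w, -1 <= X w - X u <= 1 & -1 <= Y w - Y u <= 1].
Proof. by move=> ch; rewrite (chart_adj ch) => /and3P[]; split=> //; lia. Qed.

Lemma chart_neq X Y u w : lc_chart e X Y -> u != w -> X u <> X w \/ Y u <> Y w.
Proof.
move=> ch uw; have [Xuw|/eqP] := eqVneq (X u) (X w); last by left.
by right; apply/eqP; apply: contraNneq uw => /(chart_inj ch Xuw) ->.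
Qed.

Lemma chart_nonedge X Y u w : lc_chart e X Y -> ~~ e u w -> u != w ->
  1 < X w - X u \/ 1 < X u - X w \/ 1 < Y w - Y u \/ 1 < Y u - Y w.
Proof. by move=> ch; rewrite (chart_adj ch) => + uw; rewrite uw /=; clear; lia. Qed.

Lemma chart_adjI X Y u w : lc_chart e X Y -> X u <> X w \/ Y u <> Y w ->
  -1 <= X w - X u <= 1 -> -1 <= Y w - Y u <= 1 -> e u w.
Proof.
move=> ch neq Xuw Yuw; rewrite (chart_adj ch); apply/and3P; split; try by clear neq; lia.
by apply/eqP=> uw; case: neq; rewrite uw.
Qed.

(** * Connectedness of neighbourhoods *)

Section NoCutVertex.

Hypothesis conn : two_connected e.

(* Otherwise v is alone in its column and separates s from t. *)
Lemma axis_gap X Y v s t : lc_chart e X Y ->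
  Y s = Y v -> X s = X v + 1 -> Y t = Y v -> X t = X v - 1 ->
  exists2 r, e v r & e s r /\ e t r.
Proof.
move=> ch Ys Xs Yt Xt.
have [/existsP[r /andP[/eqP Xr /eqP Yr]]|nor] :=
  boolP [exists r, (X r == X v) && ((Y r == Y v + 1) || (Y r == Y v - 1))].
  by exists r; [|split]; apply: (chart_adjI ch); lia.
(* By convexity, another vertex in the column of [v] would put one directly above or below [v]. *)
have vX w : X w = X v -> w = v.
  move=> Xw; apply: (chart_inj ch) => //; apply/eqP; apply: contraNT nor => Yw.
  have [le|gt] := leP (Y v) (Y w).
    have [|r [Xr Yr]] := @chart_col X Y v w (Y v + 1) ch Xw; first by lia.
    by apply/existsP; exists r; lia.
  have [|r [Xr Yr]] := @chart_col X Y w v (Y v - 1) ch (esym Xw); first by lia.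
  by apply/existsP; exists r; lia.
(* Edges change [X] by at most 1, so one leaving the open half-plane to the right of [v] ends in the
   column of [v]. *)
have [||||u [w [euw _ wv Pu nPw]]] :=
  @two_connected_exit T e (fun r => X v < X r) v s t conn; try lia.
- by apply/eqP => sv; move: Xs; rewrite sv; lia.
- by apply/eqP => tv; move: Xt; rewrite tv; lia.
have [_ Xuw _] := chart_edge ch euw.
by case/eqP: wv; apply: vX; lia.
Qed.

(* Otherwise every path leaving the open quadrant at v that contains s goes
   through v. *)
Lemma corner_gap X Y v s t : lc_chart e X Y ->
  X s = X v + 1 -> Y s = Y v + 1 -> e v t -> t != s ->
  exists r, [/\ e v r, e s r & X r = X v \/ Y r = Y v].
Proof.
move=> ch Xs Ys evt ts.
have [/existsP[r rP]|nor] := boolP [exists r,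
    ((X r == X v) && (Y r == Y v + 1)) || ((X r == X v + 1) && (Y r == Y v))].
  by exists r; split; [apply: (chart_adjI ch) | apply: (chart_adjI ch) |]; lia.
have [vt Xvt Yvt] := chart_edge ch evt.
have ts' := chart_neq ch ts.
(* [t] is outside the quadrant, where [s] is the only possible neighbour of [v]. The exit edge ends
   on a bounding ray, and convexity fills the point of that ray next to [v]. *)
have [||||u [w [euw _ wv Pu nPw]]] :=
  @two_connected_exit T e (fun r => (X v < X r) && (Y v < Y r)) v s t conn; try lia.
- by apply/eqP => sv; move: Xs; rewrite sv; lia.
- by rewrite eq_sym.
have [_ Xuw Yuw] := chart_edge ch euw; have wv' := chart_neq ch wv.
case/negP: nor; apply/existsP.
have [Xw|Xw] := eqVneq (X w) (X v).
  have [|r [Xr Yr]] := @chart_col X Y v w (Y v + 1) ch Xw; first by lia.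
  by exists r; lia.
have [|| r [Xr Yr]] := @chart_row X Y v w (X v + 1) ch; try lia.
by exists r; lia.
Qed.

End NoCutVertex.

(** A diagonal neighbour is moved to the upper right corner by reflections, hence the minus signs;
    an axial one serves as its own [r]. *)
Lemma corner_axis X Y v s t : two_connected e -> lc_chart e X Y -> e v s -> e v t -> t != s ->
  exists r, [/\ e v r, (r == s) || e s r & X r = X v \/ Y r = Y v].
Proof.
move=> conn ch evs evt ts; have [_ Xvs Yvs] := chart_edge ch evs.
have gap X' Y' : lc_chart e X' Y' -> X' s = X' v + 1 -> Y' s = Y' v + 1 ->
    exists r, [/\ e v r, (r == s) || e s r & X' r = X' v \/ Y' r = Y' v].
  move=> ch' Xs Ys; have [r [evr esr rax]] := corner_gap conn ch' Xs Ys evt ts.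
  by exists r; rewrite esr orbT.
have [ax|[[Xs|Xs] [Ys|Ys]]] : (X s = X v \/ Y s = Y v) \/
    [\/ X s = X v + 1 | - X s = - X v + 1] /\ [\/ Y s = Y v + 1 | - Y s = - Y v + 1].
- by clear -Xvs Yvs; lia.
- by exists s; rewrite eqxx.
- exact: gap ch Xs Ys.
- have [r [? ? rax]] := gap _ _ (chart_oppY ch) Xs Ys; exists r; split=> //.
  by case: rax => [|/oppr_inj]; auto.
- have [r [? ? rax]] := gap _ _ (chart_oppX ch) Xs Ys; exists r; split=> //.
  by case: rax => [/oppr_inj|]; auto.
have [r [? ? rax]] := gap _ _ (chart_oppX (chart_oppY ch)) Xs Ys; exists r; split=> //.
by case: rax => /oppr_inj; auto.
Qed.

(** Perpendicular axial neighbours are adjacent; opposite ones are linked by [axis_gap]. *)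
Lemma axis_axis X Y v r s : two_connected e -> lc_chart e X Y -> e v r -> e v s -> r != s ->
  (X r = X v \/ Y r = Y v) -> (X s = X v \/ Y s = Y v) ->
  e r s \/ exists q, [/\ e v q, e r q & e s q].
Proof.
move=> conn ch evr evs rs rax sax.
have gap X' Y' a b : lc_chart e X' Y' -> Y' a = Y' v -> X' a = X' v + 1 -> Y' b = Y' v ->
    X' b = X' v - 1 -> exists q, [/\ e v q, e a q & e b q].
  by move=> ch' Ya Xa Yb Xb; have [q ? [? ?]] := axis_gap conn ch' Ya Xa Yb Xb; exists q.
have [vr Xvr Yvr] := chart_edge ch evr; have {}vr := chart_neq ch vr.
have [vs Xvs Yvs] := chart_edge ch evs; have {}vs := chart_neq ch vs.
have {}rs := chart_neq ch rs.
have pos u : -1 <= X u - X v <= 1 -> -1 <= Y u - Y v <= 1 -> X v <> X u \/ Y v <> Y u ->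
    X u = X v \/ Y u = Y v ->
    (X u = X v /\ (Y u = Y v + 1 \/ Y u = Y v - 1)) \/
    (Y u = Y v /\ (X u = X v + 1 \/ X u = X v - 1)).
  by clear; lia.
have near : -1 <= X s - X r <= 1 -> -1 <= Y s - Y r <= 1 -> e r s by apply: (chart_adjI ch).
have [[Xr [Yr|Yr]]|[Yr [Xr|Xr]]] := pos r Xvr Yvr vr rax;
  have [[Xs [Ys|Ys]]|[Ys [Xs|Xs]]] := pos s Xvs Yvs vs sax.
all: first
  [ by left; apply: near; clear -Xr Yr Xs Ys; lia
  | by right; apply: (gap _ _ _ _ ch)
  | by right; apply: (gap _ _ _ _ (chart_swap ch))
  | by right; have [q [? ? ?]] := gap _ _ s r ch Ys Xs Yr Xr; exists q
  | by right; have [q [? ? ?]] := gap _ _ s r (chart_swap ch) Xs Ys Xr Yr; exists q ].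
Qed.

(** If no edge among neighbours of [v] left [P], then [P] would be constant along a chain from [a]
    to an axial neighbour, on to another one, and from there to [b]. *)
Lemma locally_connected X Y (P : pred T) v a b : two_connected e -> lc_chart e X Y ->
  e v a -> e v b -> P a -> ~~ P b ->
  exists s t, [/\ e v s, e v t, e s t, P s & ~~ P t].
Proof.
move=> conn ch eva evb Pa nPb.
have e_sym := chart_sym ch.
have [/existsP[s /existsP[t /and5P[? ? ? ? ?]]]|none] := boolP [exists s, exists t,
    [&& e v s, e v t, e s t, P s & ~~ P t]]; first by exists s, t.
have PE s t : e v s -> e v t -> e s t -> P s = P t.
  move=> evs evt est; apply/idP/idP => [Ps|Pt]; apply: contraNT none => nP.
    by apply/existsP; exists s; apply/existsP; exists t; apply/and5P.
  by apply/existsP; exists t; apply/existsP; exists s; rewrite e_sym in est; apply/and5P.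
have ab : a != b by apply: contraNneq nPb => <-.
have axis s t : e v s -> e v t -> t != s ->
    exists r, [/\ e v r, P r = P s & X r = X v \/ Y r = Y v].
  move=> evs evt ts; have [r [evr sr rax]] := corner_axis conn ch evs evt ts.
  by exists r; split=> //; case/predU1P: sr => [-> // | esr]; rewrite (PE s r).
have [|r [evr Pr rax]] := axis a b eva evb; first by rewrite eq_sym.
have [r' [evr' Pr' rax']] := axis b a evb eva ab.
have rr' : r != r' by apply: contraNneq nPb => rr'; rewrite -Pr' -rr' Pr.
suff: P r = P r' by rewrite Pr Pr' Pa (negbTE nPb).
have [/PE->//|[q [evq erq er'q]]] := axis_axis conn ch evr evr' rr' rax rax'.
by rewrite (PE r q) // (PE r' q).
Qed.

(** * Positions of cycle neighbours, and triangles with one vertex off a maximal cycle *)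

Section MaximalCycleInChart.

Variable c : seq T.
Hypotheses (ucyc : ucycle e c) (c3 : (2 < size c)%N).
Hypothesis maxc : forall c', ucycle e c' -> (size c' <= size c)%N.

Lemma turn_near X Y d v : lc_chart e X Y -> v \in c ->
  -1 <= X (turn d c v) - X v <= 1 /\ -1 <= Y (turn d c v) - Y v <= 1.
Proof.
move=> ch vc; have [_ ? ?] := chart_edge ch (turn_adj (chart_sym ch) ucyc d vc).
by [].
Qed.

Lemma turn_far X Y d x v : lc_chart e X Y -> x \notin c -> v \in c -> e v x ->
  let w := turn d c v in
  1 < X w - X x \/ 1 < X x - X w \/ 1 < Y w - Y x \/ 1 < Y x - Y w.
Proof.
move=> ch xc vc evx; apply: (chart_nonedge ch).
  exact: (max_insert (chart_sym ch) ucyc maxc d xc vc evx).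
by apply: contraNneq xc => ->; rewrite mem_turn.
Qed.

Lemma turns_far X Y d x v w : lc_chart e X Y -> x \notin c -> v \in c -> w \in c ->
  v != w -> e v x -> e x w ->
  let v' := turn d c v in let w' := turn d c w in
  1 < X w' - X v' \/ 1 < X v' - X w' \/ 1 < Y w' - Y v' \/ 1 < Y v' - Y w'.
Proof.
move=> ch xc vc wc vw evx exw; apply: (chart_nonedge ch).
  exact: (max_cross (chart_sym ch) ucyc maxc d xc vc wc vw evx exw).
by rewrite (inj_eq (turn_inj ucyc (d := d))).
Qed.

Lemma bypass_far X Y d d' x u v : lc_chart e X Y -> x \notin c -> u \in c -> v \in c ->
  u != v -> e u x -> e x v ->
  -1 <= X (turn (~~ d) c v) - X (turn d c v) <= 1 ->
  -1 <= Y (turn (~~ d) c v) - Y (turn d c v) <= 1 ->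
  let w := turn d' c u in
  1 < X w - X v \/ 1 < X v - X w \/ 1 < Y w - Y v \/ 1 < Y v - Y w.
Proof.
move=> ch xc uc vc uv eux exv Xd Yd.
(* Otherwise [v], being adjacent to [x], would let [x] be inserted between [u] and [v]. *)
have tuv : turn d' c u != v.
  apply: contraTneq exv => <-.
  exact: (max_insert (chart_sym ch) ucyc maxc d' xc uc eux).
apply: (chart_nonedge ch); last by rewrite eq_sym.
apply: (max_bypass (chart_sym ch) ucyc maxc xc uc vc uv tuv eux exv (d := d)).
apply: (chart_adjI ch _ Xd Yd); apply: (chart_neq ch).
exact: (turn_neq ucyc).
Qed.

Lemma turn_distinct X Y d v : lc_chart e X Y -> v \in c ->
  X (turn d c v) <> X (turn (~~ d) c v) \/ Y (turn d c v) <> Y (turn (~~ d) c v).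
Proof. by move=> ch vc; apply: (chart_neq ch); apply: (turn_neq ucyc). Qed.

(** With [x] as origin, the cycle neighbours of [v] lie in column -2 and those of [w] in row 2. Both
    cycle neighbours of the corner (-1, 1) are then forced to the point (-2, 2). *)
Lemma no_right_angle_off_cycle X Y x v w : lc_chart e X Y -> x \notin c ->
  X v = X x - 1 -> Y v = Y x -> X w = X x -> Y w = Y x + 1 ->
  v \in c -> w \in c -> False.
Proof.
move=> ch xc Xv Yv Xw Yw vc wc.
have e_sym := chart_sym ch.
have vw : v != w by apply/eqP => vw; move: Xv Xw; rewrite vw; clear; lia.
have evx : e v x by apply: (chart_adjI ch); clear -Xv Yv; lia.
have exw : e x w by apply: (chart_adjI ch); clear -Xw Yw; lia.
have ewx : e w x by rewrite e_sym.
have vcol d : X (turn d c v) = X x - 2 /\ -1 <= Y (turn d c v) - Y x <= 1.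
  move: (turn_near d ch vc) (turn_far d ch xc vc evx) => /=.
  by clear -Xv Yv; lia.
have wrow d : Y (turn d c w) = Y x + 2 /\ -1 <= X (turn d c w) - X x <= 1.
  move: (turn_near d ch wc) (turn_far d ch xc wc ewx) => /=.
  by clear -Xw Yw; lia.
have Yvd : Y (turn true c v) <> Y (turn false c v).
  by move: (turn_distinct true ch vc) (vcol true) (vcol false) => /=; clear; lia.
have Xwd : X (turn true c w) <> X (turn false c w).
  by move: (turn_distinct true ch wc) (wrow true) (wrow false) => /=; clear; lia.
(* The corner u completing the unit square v, x, w is a vertex: if not, row,
   column and diagonal convexity around u contradict each other. *)
have [u [Xu Yu]] : exists u, X u = X x - 1 /\ Y u = Y x + 1.
  have [/existsP[u /andP[/eqP ? /eqP ?]]|nou] :=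
    boolP [exists u, (X u == X x - 1) && (Y u == Y x + 1)]; first by exists u.
  have {}nou u : X u = X x - 1 -> Y u = Y x + 1 -> False.
    by move=> Xu Yu; case/existsP: nou; exists u; rewrite Xu Yu !eqxx.
  have vtop d : Y (turn d c v) <> Y x + 1.
    move=> Yd; have [|| u [Xu Yu]] := chart_row (u := turn d c v) (w := w) (m := X x - 1) ch.
    - by rewrite Yd.
    - by move: (vcol d) Xw; clear; lia.
    by apply: (nou u) => //; rewrite Yu Yd.
  have wleft d : X (turn d c w) <> X x - 1.
    move=> Xd; have [|| u [Xu Yu]] := chart_col (u := v) (w := turn d c w) (m := Y x + 1) ch.
    - by rewrite Xd.
    - by move: (wrow d) Yv; clear; lia.
    by apply: (nou u) => //; rewrite Xu Xv.
  have [d Yd] : exists d, Y (turn d c v) = Y x.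
    have [?|?] : Y (turn true c v) = Y x \/ Y (turn false c v) = Y x.
      by move: Yvd (vcol true) (vcol false) (vtop true) (vtop false); clear; lia.
    - by exists true.
    by exists false.
  have [d' Xd'] : exists d, X (turn d c w) = X x.
    have [?|?] : X (turn true c w) = X x \/ X (turn false c w) = X x.
      by move: Xwd (wrow true) (wrow false) (wleft true) (wleft false); clear; lia.
    - by exists true.
    by exists false.
  have [Xd _] := vcol d; have [Yd' _] := wrow d'.
  have [||u [Xu Yu]] := @chart_convex _ _ _ _ ch 1 1 1 2 (turn d c v) (turn d' c w) isT isT _ _ isT.
  - by move: Xd Xd'; clear; lia.
  - by move: Yd Yd'; clear; lia.
  by exists u; split; [move: Xu Xd|move: Yu Yd]; clear; lia.
have evu : e v u by apply: (chart_adjI ch); move: Xv Yv Xu Yu; clear; lia.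
(* If [u] is off [c], excluding its insertion next to [v] sends both cycle neighbours of [v] to (-2,
   -1), relative to [x]. *)
have [uc|uc] := boolP (u \in c); last first.
  move: (turn_far true ch uc vc evu) (turn_far false ch uc vc evu) => /=.
  by move: Yvd (vcol true) (vcol false) Xu Yu; clear; lia.
have uv : u != v by apply/eqP => uv; move: Yv Yu; rewrite uv; clear; lia.
have uw : u != w by apply/eqP => uw; move: Xw Xu; rewrite uw; clear; lia.
have eux : e u x by apply: (chart_adjI ch); move: Xu Yu; clear; lia.
have unear d := turn_near d ch uc.
have ufar d := turn_far d ch xc uc eux.
have vw_far d := turns_far d ch xc vc wc vw evx exw.
have uv_far d := turns_far d ch xc uc vc uv eux (etrans (e_sym _ _) evx).
have uw_far d := turns_far d ch xc uc wc uw eux exw.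
(* The neighbours of [u], [v], [w] in one direction are pairwise far apart. With that of [v] at (-2,
   1), that of [u] would be at (0, 2), too close to that of [w]. *)
have vlow d : Y (turn d c v) <> Y x + 1.
  move: (vcol d) (wrow d) (unear d) (ufar d) (vw_far d) (uv_far d) (uw_far d) => /=.
  by move: Xu Yu; clear; lia.
have wright d : X (turn d c w) <> X x - 1.
  move: (vcol d) (wrow d) (unear d) (ufar d) (vw_far d) (uv_far d) (uw_far d) => /=.
  by move: Xu Yu; clear; lia.
(* The two cycle neighbours of [v] are now close to each other, as are those of [w]. Both vertices
   can be bypassed, so those of [u] are far from both. *)
have upos d : X (turn d c u) = X x - 2 /\ Y (turn d c u) = Y x + 2.
  have := bypass_far (d := true) d ch xc uc vc uv eux (etrans (e_sym _ _) evx).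
  have := bypass_far (d := true) d ch xc uc wc uw eux exw.
  move: (vlow true) (vlow false) (wright true) (wright false) => /=.
  move: (vcol true) (vcol false) (wrow true) (wrow false) (unear d) (ufar d) => /=.
  move: Xu Yu Xv Yv Xw Yw; clear.
  move=> Xu Yu Xv Yv Xw Yw [v1 v1'] [v2 v2'] [w1 w1'] [w2 w2'] ud ud' l1 l2 r1 r2 bw bv.
  have {}bw : 1 < X (turn d c u) - X w \/ 1 < X w - X (turn d c u)
    \/ 1 < Y (turn d c u) - Y w \/ 1 < Y w - Y (turn d c u) by apply: bw; clear bv ud ud'; lia.
  have {}bv : 1 < X (turn d c u) - X v \/ 1 < X v - X (turn d c u)
    \/ 1 < Y (turn d c u) - Y v \/ 1 < Y v - Y (turn d c u) by apply: bv; clear bw ud ud'; lia.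
  by clear v1 v1' v2 v2' w1 w1' w2 w2' l1 l2 r1 r2; lia.
by move: (turn_distinct true ch uc) (upos true) (upos false) => /=; clear; lia.
Qed.

(** The right angle is at [v]. With [x] as origin, the cycle neighbours of [v] lie in row -2, while
    one of [w] is forced to (0, -2), too close to all their possible positions. *)
Lemma no_right_angle_on_cycle X Y x v w : lc_chart e X Y -> x \notin c ->
  X v = X x -> Y v = Y x - 1 -> X w = X x + 1 -> Y w = Y x - 1 ->
  v \in c -> w \in c -> False.
Proof.
move=> ch xc Xv Yv Xw Yw vc wc.
have e_sym := chart_sym ch.
have vw : v != w by apply/eqP => vw; move: Xv Xw; rewrite vw; clear; lia.
have evx : e v x by apply: (chart_adjI ch); clear -Xv Yv; lia.
have exw : e x w by apply: (chart_adjI ch); clear -Xw Yw; lia.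
have ewx : e w x by rewrite e_sym.
have vrow d : Y (turn d c v) = Y x - 2 /\ -1 <= X (turn d c v) - X x <= 1.
  move: (turn_near d ch vc) (turn_far d ch xc vc evx) => /=.
  by clear -Xv Yv; lia.
have wnear d := turn_near d ch wc.
have wfar d := turn_far d ch xc wc ewx.
(* Convexity would make the point right of x a vertex: off c because of the
   previous lemma, yet insertable between w and its cycle neighbour. *)
have wE d : X (turn d c w) = X x + 2 -> Y (turn d c w) = Y x -> False.
  move=> Xd Yd.
  have [||r [Xr Yr]] := chart_row (u := x) (w := turn d c w) (m := X x + 1) ch => //.
    by move: Xd; clear; lia.
  have [rc|rc] := boolP (r \in c).
    apply: (no_right_angle_off_cycle (x := x) (v := r) (w := v) (chart_oppX (chart_oppY ch)) xc) => //.
    - by move: Xr; clear; lia.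
    - by rewrite Yr.
    - by rewrite Xv.
    by move: Yv; clear; lia.
  have ewr : e w r by apply: (chart_adjI ch); move: Xw Yw Xr Yr; clear; lia.
  move: (turn_far d ch rc wc ewr) => /=.
  by move: Xr Yr Xd Yd; clear; lia.
(* If the cycle neighbours of [w] were adjacent, bypassing [w] would force both of those of [v] to
   (-1, -2). *)
have wgap : 1 < X (turn false c w) - X (turn true c w) \/ 1 < X (turn true c w) - X (turn false c w)
    \/ 1 < Y (turn false c w) - Y (turn true c w) \/ 1 < Y (turn true c w) - Y (turn false c w).
  have vX d : -1 <= X (turn false c w) - X (turn true c w) <= 1 ->
      -1 <= Y (turn false c w) - Y (turn true c w) <= 1 -> X (turn d c v) = X x - 1.
    move=> nX nY.
    move: (bypass_far (d := true) d ch xc vc wc vw evx exw nX nY) (vrow d) => /=.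
    by move: Xw Yw; clear; lia.
  have [nX|?] : -1 <= X (turn false c w) - X (turn true c w) <= 1 \/
    (1 < X (turn false c w) - X (turn true c w) \/ 1 < X (turn true c w) - X (turn false c w)).
  - by clear; lia.
  have [nY|?] : -1 <= Y (turn false c w) - Y (turn true c w) <= 1 \/
    (1 < Y (turn false c w) - Y (turn true c w) \/ 1 < Y (turn true c w) - Y (turn false c w)).
  - by clear; lia.
  - move: (vX true nX nY) (vX false nX nY) (vrow true) (vrow false).
    by move: (turn_distinct true ch vc) => /=; clear; lia.
  - by right; right.
  by tauto.
have wpos d : (X (turn d c w) = X x + 2 /\ -2 <= Y (turn d c w) - Y x <= -1) \/
    (Y (turn d c w) = Y x - 2 /\ 0 <= X (turn d c w) - X x <= 1).
  by move: (wnear d) (wfar d) (wE d) => /=; move: Xw Yw; clear; lia.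
(* The positions left are (2, -2), (2, -1), (1, -2) and (0, -2); two far apart must include the
   last. *)
have [d [Xd Yd]] : exists d, X (turn d c w) = X x /\ Y (turn d c w) = Y x - 2.
  suff [?|?] : (X (turn true c w) = X x /\ Y (turn true c w) = Y x - 2) \/
    (X (turn false c w) = X x /\ Y (turn false c w) = Y x - 2) by [exists true | exists false].
  by move: wgap (wpos true) (wpos false); clear; lia.
move: (turns_far d ch xc vc wc vw evx exw) (vrow d) => /=.
by move: Xd Yd; clear; lia.
Qed.

(** A triangle of the supergrid is half a unit square, so it has a right angle: at [x], or at [v] or
    [w]. *)
Lemma no_triangle_off_cycle X Y x v w : lc_chart e X Y -> x \notin c ->
  v \in c -> w \in c -> e v x -> e w x -> e v w -> False.
Proof.
move=> ch xc vc wc evx ewx evw.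
have right_angle X' Y' p q : lc_chart e X' Y' -> p \in c -> q \in c ->
    X' p = X' x + 1 \/ X' p = X' x - 1 -> Y' p = Y' x -> X' q = X' x ->
    Y' q = Y' x + 1 \/ Y' q = Y' x - 1 -> False.
  move=> ch' pc qc Xp Yp Xq Yq.
  case: Xp => Xp; case: Yq => Yq.
  - by apply: (no_right_angle_off_cycle (chart_oppX ch') xc _ _ _ _ pc qc);
      clear -Xp Yp Xq Yq; lia.
  - by apply: (no_right_angle_off_cycle (chart_oppX (chart_oppY ch')) xc _ _ _ _ pc qc);
      clear -Xp Yp Xq Yq; lia.
  - by apply: (no_right_angle_off_cycle ch' xc _ _ _ _ pc qc);
      clear -Xp Yp Xq Yq; lia.
  - by apply: (no_right_angle_off_cycle (chart_oppY ch') xc _ _ _ _ pc qc);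
      clear -Xp Yp Xq Yq; lia.
(* Here the angle at [x] is acute and [p] carries the right angle. *)
have acute X' Y' p q : lc_chart e X' Y' -> p \in c -> q \in c ->
    X' p = X' x -> Y' p = Y' x + 1 \/ Y' p = Y' x - 1 ->
    X' q = X' x + 1 \/ X' q = X' x - 1 -> Y' q = Y' p -> False.
  move=> ch' pc qc Xp Yp Xq Yq.
  case: Yp => Yp; case: Xq => Xq.
  - by apply: (no_right_angle_on_cycle (chart_oppY ch') xc _ _ _ _ pc qc);
      clear -Xp Yp Xq Yq; lia.
  - by apply: (no_right_angle_on_cycle (chart_oppX (chart_oppY ch')) xc _ _ _ _ pc qc);
      clear -Xp Yp Xq Yq; lia.
  - by apply: (no_right_angle_on_cycle ch' xc _ _ _ _ pc qc);
      clear -Xp Yp Xq Yq; lia.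
  - by apply: (no_right_angle_on_cycle (chart_oppX ch') xc _ _ _ _ pc qc);
      clear -Xp Yp Xq Yq; lia.
have ring p : e p x -> (X p = X x - 1 \/ X p = X x \/ X p = X x + 1) /\
    (Y p = Y x - 1 \/ Y p = Y x \/ Y p = Y x + 1) /\ (X p <> X x \/ Y p <> Y x).
  move=> epx; have [px Xpx Ypx] := chart_edge ch epx.
  by move: (chart_neq ch px) Xpx Ypx; clear; lia.
have [vw Xvw Yvw] := chart_edge ch evw.
have {}vw := chart_neq ch vw.
case: (ring v evx) (ring w ewx) => [Xv [Yv xv]] [Xw [Yw xw]].
case: Xv => [Xv|[Xv|Xv]]; case: Yv => [Yv|[Yv|Yv]];
  case: Xw => [Xw|[Xw|Xw]]; case: Yw => [Yw|[Yw|Yw]].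
(* Arithmetic discards the positions that form no triangle; exchanging [v] with [w], or the axes,
   reduces the others to the two cases above. *)
all: first
  [ by clear -Xvw Yvw vw xv xw Xv Yv Xw Yw; lia
  | by apply: (right_angle X Y v w); auto
  | by apply: (right_angle X Y w v); auto
  | by apply: (acute X Y v w); auto; congruence
  | by apply: (acute X Y w v); auto; congruence
  | by apply: (acute Y X v w (chart_swap ch)); auto; congruence
  | by apply: (acute Y X w v (chart_swap ch)); auto; congruence ].
Qed.

Lemma maximal_cycle_spans X Y x : two_connected e -> lc_chart e X Y -> x \in c.
Proof.
move=> conn ch; apply/negPn/negP => xc.
have [v0 v0c] : exists v, v \in c by case: (c) c3 => // v s _; exists v; apply: mem_head.
have v0x : v0 != x by apply: contraNneq xc => <-.
have [s [_ [/andP[ps _] _ _ _]]] := conn.2 _ _ v0x.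
have [|v [y [evy _ _ vc yc]]] := path_exit (P := mem c) ps v0c.
  by rewrite last_rcons.
have evt := turn_adj (chart_sym ch) ucyc true vc.
(* Around [v], its successor is on [c] and [y] is not. The crossing edge closes a triangle whose
   vertex off [c] is [z], possibly different from [x]. *)
have [|w [z [evw evz ewz wc zc]]] := locally_connected (P := mem c) conn ch evt evy _ yc.
  by rewrite /= mem_turn.
have e_sym := chart_sym ch.
by apply: (no_triangle_off_cycle ch zc vc wc _ ewz).
Qed.

End MaximalCycleInChart.

End Charts.

(** * Existence of a longest cycle, and conclusion *)

Lemma exists_maximal_ucycle (T : finType) (e : rel T) c0 : ucycle e c0 ->
  exists c, [/\ ucycle e c, (size c0 <= size c)%N
    & forall c', ucycle e c' -> (size c' <= size c)%N].
Proof.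
(* Tuples of fixed length over [T] form a finite type, which makes [P] Boolean. *)
move=> ucyc0; pose P n := [exists t : n.-tuple T, cycle e t && uniq t].
have PE c : ucycle e c -> P (size c).
  by case/andP=> ec uc; apply/existsP; exists (in_tuple c); rewrite ec uc.
have exP : exists n, P n by exists (size c0); apply: PE.
have ubP n : P n -> (n <= #|T|)%N.
  by case/existsP=> t /andP[_ ut]; rewrite -(size_tuple t) -(card_uniqP ut) max_card.
case: (ex_maxnP exP ubP) => n /existsP[t /andP[et ut]] maxn.
exists t; rewrite size_tuple; split; first by rewrite /ucycle et ut.
  exact/maxn/PE.
by move=> c' /PE/maxn.
Qed.

Local Close Scope ring_scope.

Theorem theorem3 (V : {fset point}) :
  two_connected (supergrid V) ->
  linear_convex V ->
  exists c : seq V, hamiltonian_cycle (supergrid V) c.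
Proof.
move=> conn convV; have ch := supergrid_chart convV.
(* Starting from a genuine cycle keeps the maximal one from being degenerate. *)
have [c0 ucyc0 c03] := two_connected_cycle (chart_sym ch) conn.
have [c [ucyc c0c maxc]] := exists_maximal_ucycle ucyc0.
have c3 : 2 < size c by apply: leq_trans c0c.
by exists c; split=> // x; apply: (maximal_cycle_spans ucyc c3 maxc x conn ch).
Qed.
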